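(* Let $\tilde Z(s)=(z_1(s),\dots,z_N(s))^T$, with $z_i(s)=\mathbb{E}(e^{-sW}1_{\{Y=i\}})$, satisfy $$\tilde Z(s)=H(s)\sum_{i=1}^{N}\tilde P^{(i)}\tilde Z(\alpha_i(s))+\tilde V(s),\qquad \mathrm{Re}(s)\ge 0,$$ in the setting described in the context, where $a$ denotes the common fixed point of the commuting contractions $\alpha_1,\dots,\alpha_N$ and $\kappa\in(0,1)$ their common contraction constant. Assume that $\mathbb{E}(W)<\infty$, that $\tilde V$ is analytic in a neighborhood of $a$ with $\tilde V(a)=\tilde 0$, and that $$\|H(a)\|_1\,\kappa<1 .$$ Then for $\mathrm{Re}(s)\ge 0$ $$\tilde Z(s)=\sum_{k=0}^{\infty}\ \sum_{i_1+\cdots+i_N=k}F_{i_1,\dots,i_N}(s)\,\tilde V(\alpha_{i_1,\dots,i_N}(s))+\lim_{n\to\infty}\ \sum_{i_1+\cdots+i_N=n+1}F_{i_1,\dots,i_N}(s)\,\tilde Z(a),$$ where the series converges absolutely and the limit exists.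
   Context: $N\ge1$, $E=\{1,\dots,N\}$, $\mathbb{C}_+=\{s\in\mathbb{C}:\mathrm{Re}(s)\ge 0\}$. $W$ is a non-negative random variable and $Y$ is an $E$-valued random variable on the same probability space ($Y$ is the stationary state of a background Markov chain, with distribution $\tilde\pi=(\pi_1,\dots,\pi_N)^T$). $\tilde 0$ is the $N\times1$ zero vector. $H(s)$ is a known $N\times N$ matrix function and $\tilde V(s)$ a known $N\times 1$ vector function; there is $\zeta>0$ such that all their entries are analytic in $\mathrm{Re}(s)>-\zeta$. $\tilde P^{(i)}=e_ie_i^T$ is the $N\times N$ matrix with $(i,i)$ entry $1$ and all other entries $0$. $\|\cdot\|_1$ is the matrix $1$-norm (maximum absolute column sum). The maps $\alpha_i:\mathbb{C}_+\to\mathbb{C}_+$, $i=1,\dots,N$, satisfy $|\alpha_i(s)-\alpha_i(u)|\le\kappa|s-u|$ for all $s,u\in\mathbb{C}_+$ with a common $\kappa\in(0,1)$, and commute: $\alpha_i(\alpha_j(s))=\alpha_j(\alpha_i(s))$. They have a common fixed point $a$. For non-negative integers $i_1,\dots,i_N$: $\alpha_{i_1,\dots,i_N}(s)=\alpha_1^{i_1}(\alpha_2^{i_2}(\cdots(\alpha_N^{i_N}(s))\cdots))$, where $\alpha_i^{n}$ is the $n$th iterate of $\alpha_i$ and $\alpha_{0,\dots,0}(s)=s$. The $N\times N$ matrices $F_{i_1,\dots,i_N}(s)$ are defined recursively by $F_{0,\dots,0}(s)=I$, $F_{i_1,\dots,i_N}(s)=O$ (zero matrix) if one of the indices equals $-1$,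 and $$F_{i_1,\dots,i_N}(s)=\sum_{k=1}^{N}F_{i_1,\dots,i_k-1,\dots,i_N}(s)\,H(\alpha_{i_1,\dots,i_k-1,\dots,i_N}(s))\,\tilde P^{(k)} .$$ *)

(* Defs.v *)
From HB Require Import structures.
From mathcomp Require Import all_boot all_order all_algebra.
From mathcomp Require Import all_classical all_reals all_analysis.
From mathcomp Require Export complex.
Import numFieldNormedType.Exports.
Import Order.TTheory GRing.Theory Num.Theory.

Set Implicit Arguments.
Unset Strict Implicit.
Unset Printing Implicit Defensive.

Local Open Scope classical_set_scope.
Local Open Scope ring_scope.
Local Open Scope complex_scope.

(* [R[i]] itself carries no topology; limits are taken in the regular module
   [R[i]^o], which is convertible to [R[i]] and has the topology of the
   modulus. *)

Section ComplexAnalysis.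
Variable R : realType.

Definition cexp (z : R[i]) : R[i] :=
  (expR (complex.Re z) * cos (complex.Im z))
    +i* (expR (complex.Re z) * sin (complex.Im z)).

(* The expectation of a complex random variable, by real and imaginary parts.
   [fine] makes it total; it is the usual value as soon as X is integrable. *)
Definition cexpectation d (T : measurableType d) (P : probability T R)
    (X : T -> R[i]) : R[i] :=
  fine 'E_P[fun w => complex.Re (X w)]
    +i* fine 'E_P[fun w => complex.Im (X w)].

Definition analytic_at (f : R[i] -> R[i]) (z0 : R[i]) : Prop :=
  exists (c : nat -> R[i]) (r : R), 0 < r /\
    forall z : R[i], `|z - z0| < r%:C ->
      series (fun n => c n * (z - z0) ^+ n : R[i]^o) @ \oo --> (f z : R[i]^o).

Definition mxnorm1 m n (A : 'M[R[i]]_(m, n)) : R :=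
  \big[Num.max/0]_(j < n) \sum_(i < m) ComplexField.Normc.normc (A i j).

(* s |-> (E[e^{-sW} 1_{Y = i}])_i *)
Definition jointLST d (T : measurableType d) (P : probability T R) (N : nat)
    (W : T -> R) (Y : T -> 'I_N) (s : R[i]) : 'cV[R[i]]_N :=
  \col_i cexpectation P (fun w => cexp (- s * (W w)%:C) * (Y w == i)%:R).

End ComplexAnalysis.

Section MultiIndex.
Variable N : nat.
Implicit Type i : {ffun 'I_N -> nat}.

Definition mdeg i : nat := (\sum_j i j)%N.

Definition mdecr i (k : 'I_N) : {ffun 'I_N -> nat} :=
  [ffun j => if j == k then (i j).-1 else i j].

(* Sum over all multi-indices of degree n; each component is at most n, so
   ['I_n.+1] suffices as range. *)
Definition sum_mdeg (V : nmodType) (n : nat) (G : {ffun 'I_N -> nat} -> V) : V :=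
  \sum_(i : {ffun 'I_N -> 'I_n.+1} | (\sum_j i j)%N == n)
    G [ffun j => nat_of_ord (i j)].

End MultiIndex.

Section Iteration.
Variables (R : realType) (N : nat).
Variables (alpha : 'I_N -> R[i] -> R[i]) (H : R[i] -> 'M[R[i]]_N).
Implicit Type i : {ffun 'I_N -> nat}.

Definition Pmx (k : 'I_N) : 'M[R[i]]_N := delta_mx k k.

(* alpha_1^{i_1} (alpha_2^{i_2} (... (alpha_N^{i_N} s))) *)
Definition malpha i (s : R[i]) : R[i] :=
  foldr (fun k z => iter (i k) (alpha k) z) s (enum 'I_N).

(* Recursion on the degree n of i.  Terms in which decrementing i_k would give
   the index -1 are zero. *)
Fixpoint Fmx_rec (n : nat) i (s : R[i]) : 'M[R[i]]_N :=
  if n is n'.+1 then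
    \sum_k (if i k == 0%N then 0
            else Fmx_rec n' (mdecr i k) s
                   *m H (malpha (mdecr i k) s) *m Pmx k)
  else 1%:M.

Definition Fmx i (s : R[i]) : 'M[R[i]]_N := Fmx_rec (mdeg i) i s.

Lemma Fmx0 s : Fmx [ffun=> 0%N] s = 1%:M.
Proof. by rewrite /Fmx /mdeg big1// => j _; rewrite ffunE. Qed.

Lemma FmxE i s : mdeg i != 0%N ->
  Fmx i s = \sum_k (if i k == 0%N then 0
                    else Fmx (mdecr i k) s
                           *m H (malpha (mdecr i k) s) *m Pmx k).
Proof.
rewrite /Fmx; case E : (mdeg i) => [//|n] _ /=.
apply: eq_bigr => k _; case: ifPn => // ik.
suff -> : mdeg (mdecr i k) = n by [].
apply/eqP; rewrite -eqSS -E /mdeg (bigD1 k)//= [X in _ == X](bigD1 k)//=.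
rewrite ffunE eqxx -addSn prednK ?lt0n// eqn_add2l; apply/eqP.
by apply: eq_bigr => j /negbTE jk; rewrite ffunE jk.
Qed.

End Iteration.

(* Main.v *)
Require Import Defs.
From HB Require Import structures.
From mathcomp Require Import all_boot all_order all_algebra.
From mathcomp Require Import all_classical all_reals all_analysis.
From mathcomp Require Import measurable_realfun ring lra.
Import numFieldNormedType.Exports.
Import Order.TTheory GRing.Theory Num.Theory.
Local Open Scope classical_set_scope.
Local Open Scope ring_scope.
Local Open Scope complex_scope.

(* Iterating the functional equation n times expresses Z(s) as the sum of the
   terms of degree < n plus the sum over |i| = n of F_i(s) Z(alpha_i(s)).
   Column c of F_i(s) is F_{i-e_c}(s) applied to column c of
   H(alpha_{i-e_c}(s)).  Since alpha_i(s) -> a, the sums over |i| = n of the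
   1-norms of the columns of F_i(s) are therefore O(rho^n) for every
   rho > ||H(a)||_1, and rho can be chosen with rho kappa < 1.
   Both V (analytic, V(a) = 0) and Z - Z(a) (Lipschitz because E W < oo) are
   O(kappa^n) at alpha_i(s), |i| = n, so the series converges absolutely and
   replacing Z(alpha_i(s)) by Z(a) in the remainder costs O((rho kappa)^n). *)

Set Implicit Arguments.
Unset Strict Implicit.

Local Notation normc := ComplexField.Normc.normc.

(** * Multi-indices and sums over a fixed degree *)

Section MultiIndexSums.
Variable N : nat.
Implicit Types (i j : {ffun 'I_N -> nat}) (k : 'I_N) (n : nat).

Definition mincr j k : {ffun 'I_N -> nat} :=
  [ffun l => (j l + (l == k))%N].

Lemma mdegD1 i k : mdeg i = (i k + \sum_(l | l != k) i l)%N.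
Proof. by rewrite /mdeg (bigD1 k). Qed.

Lemma mdeg_mincr j k : mdeg (mincr j k) = (mdeg j).+1.
Proof.
rewrite !(mdegD1 _ k) ffunE eqxx addn1 addSn; congr (_ + _).+1.
by apply: eq_bigr => l /negbTE lk; rewrite ffunE lk addn0.
Qed.

Lemma mincrK j k : mdecr (mincr j k) k = j.
Proof.
by apply/ffunP => l; rewrite !ffunE; case: eqP => _; rewrite ?addn1 ?addn0.
Qed.

Lemma mdecrK i k : i k != 0%N -> mincr (mdecr i k) k = i.
Proof.
move=> ik; apply/ffunP => l; rewrite !ffunE; case: eqP => [->|_].
  by rewrite addn1 prednK// lt0n.
by rewrite addn0.
Qed.

Lemma mdeg_mdecr i k n : i k != 0%N -> mdeg i = n.+1 -> mdeg (mdecr i k) = n.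
Proof. by move=> /mdecrK <-; rewrite mdeg_mincr mincrK => -[]. Qed.

Lemma mdegS_exists i n : mdeg i = n.+1 -> exists k, i k != 0%N.
Proof.
move=> E; apply/existsP; rewrite -[X in is_true X]negbK negb_exists; apply/negP.
move=> /forallP h; move: E; rewrite /mdeg big1// => k _.
by have /negPn/eqP := h k.
Qed.

Lemma le_mdeg i k : (i k <= mdeg i)%N.
Proof. by rewrite (mdegD1 _ k) leq_addr. Qed.

(** Forgets the bound that [sum_mdeg] puts on its indices, so that the range condition and the
    summand can both be stated for unbounded multi-indices. *)
Definition ffnat m (i : {ffun 'I_N -> 'I_m.+1}) : {ffun 'I_N -> nat} :=
  [ffun l => nat_of_ord (i l)].

Lemma sum_mdegE (V : nmodType) n (G : {ffun 'I_N -> nat} -> V) :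
  sum_mdeg n G =
  \sum_(i : {ffun 'I_N -> 'I_n.+1} | mdeg (ffnat i) == n) G (ffnat i).
Proof.
apply: eq_bigl => i; rewrite /mdeg; congr (_ == _).
by apply: eq_bigr => l _; rewrite ffunE.
Qed.

Lemma eq_sum_mdeg (V : nmodType) n (G G' : {ffun 'I_N -> nat} -> V) :
  (forall i, mdeg i = n -> G i = G' i) -> sum_mdeg n G = sum_mdeg n G'.
Proof. by move=> h; rewrite !sum_mdegE; apply: eq_bigr => i /eqP/h. Qed.

Lemma sum_mdeg0 (V : nmodType) (G : {ffun 'I_N -> nat} -> V) :
  sum_mdeg 0 G = G [ffun=> 0%N].
Proof.
rewrite sum_mdegE (big_pred1 [ffun=> ord0]) => [|i /=].
  by congr G; apply/ffunP => l; rewrite !ffunE.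
have -> : i = [ffun=> ord0] by apply/ffunP => l; rewrite ffunE ord1.
rewrite eqxx; apply/eqP.
by rewrite /mdeg big1// => l _; rewrite !ffunE.
Qed.

(** Pairs (i, k) with |i| = n+1 and i_k nonzero correspond bijectively to pairs (j, k) with |j| = n
    through i = j + e_k. This turns the recursion defining F into a step between consecutive
    degrees. *)
Lemma sum_mdegS (V : nmodType) n (G : 'I_N -> {ffun 'I_N -> nat} -> V) :
  sum_mdeg n.+1 (fun i => \sum_k (if i k == 0%N then 0 else G k (mdecr i k)))
  = sum_mdeg n (fun j => \sum_k G k j).
Proof.
rewrite !sum_mdegE exchange_big [RHS]exchange_big/=; apply: eq_bigr => k _.
under eq_bigr do rewrite -if_neg.
rewrite -big_mkcondr/=.
(* The bijection and its inverse on bounded indices. A component never exceeds the degree, so for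
   the indices that are summed [inord] does not fall back on its default value. *)
pose h (j : {ffun 'I_N -> 'I_n.+1}) : {ffun 'I_N -> 'I_n.+2} :=
  [ffun l => inord (mincr (ffnat j) k l)].
pose h' (i : {ffun 'I_N -> 'I_n.+2}) : {ffun 'I_N -> 'I_n.+1} :=
  [ffun l => inord (mdecr (ffnat i) k l)].
have hE (j : {ffun 'I_N -> 'I_n.+1}) : mdeg (ffnat j) = n ->
    ffnat (h j) = mincr (ffnat j) k.
  move=> jn; apply/ffunP => l; rewrite [LHS]ffunE [h j l]ffunE inordK//.
  by have := le_mdeg (mincr (ffnat j) k) l; rewrite mdeg_mincr jn.
have h'E (i : {ffun 'I_N -> 'I_n.+2}) : mdeg (ffnat i) = n.+1 ->
    ffnat i k != 0%N -> ffnat (h' i) = mdecr (ffnat i) k.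
  move=> iN ik; apply/ffunP => l; rewrite [LHS]ffunE [h' i l]ffunE inordK//.
  by have := le_mdeg (mdecr (ffnat i) k) l; rewrite (mdeg_mdecr ik iN).
have ffI m : injective (@ffnat m).
  move=> x y /ffunP xy; apply/ffunP => l; apply/val_inj.
  by have := xy l; rewrite !ffunE.
rewrite (reindex_onto h h') => [|i /andP[/eqP iN ik]]; last first.
  by apply: ffI; rewrite hE h'E ?mdecrK//; exact: mdeg_mdecr iN.
apply: eq_big => [j|j].
  apply/andP/eqP => [[/andP[/eqP iN ik] /eqP <-]|jn].
    by rewrite h'E//; exact: mdeg_mdecr iN.
  have -> : mdeg (ffnat (h j)) = n.+1 by rewrite hE// mdeg_mincr jn.
  have ik : ffnat (h j) k != 0%N by rewrite hE// ffunE eqxx addn1.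
  rewrite eqxx ik; split=> //; apply/eqP/ffI.
  by rewrite h'E ?hE ?mincrK ?mdeg_mincr ?jn// -hE.
move=> /andP[/andP[/eqP iN ik] /eqP hj].
by rewrite -h'E// hj.
Qed.

End MultiIndexSums.

(** * Monotonicity and linearity of the degree sums *)

Section MultiIndexOrder.
Variables (N : nat).
Implicit Types (i : {ffun 'I_N -> nat}) (n : nat).

Lemma ler_sum_mdeg (R : numDomainType) n (f g : {ffun 'I_N -> nat} -> R) :
  (forall i, mdeg i = n -> f i <= g i) -> sum_mdeg n f <= sum_mdeg n g.
Proof. by move=> h; rewrite !sum_mdegE; apply: ler_sum => i /eqP/h. Qed.

Lemma sum_mdeg_ge0 (R : numDomainType) n (f : {ffun 'I_N -> nat} -> R) :
  (forall i, 0 <= f i) -> 0 <= sum_mdeg n f.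
Proof. by move=> h; exact: sumr_ge0. Qed.

Lemma sum_mdegMr (R : pzRingType) n (f : {ffun 'I_N -> nat} -> R) (x : R) :
  sum_mdeg n (fun i => f i * x) = sum_mdeg n f * x.
Proof. by rewrite /sum_mdeg mulr_suml. Qed.

Lemma sum_mdegD (V : nmodType) n (f g : {ffun 'I_N -> nat} -> V) :
  sum_mdeg n (fun i => f i + g i) = sum_mdeg n f + sum_mdeg n g.
Proof. exact: big_split. Qed.

Lemma sum_mdeg_sum (V : nmodType) (I : finType) n
    (f : I -> {ffun 'I_N -> nat} -> V) :
  sum_mdeg n (fun i => \sum_k f k i) = \sum_k sum_mdeg n (f k).
Proof. exact: exchange_big. Qed.

End MultiIndexOrder.

(** * Moduli and column norms of complex matrices *)

Section ColumnNorm.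
Variable R : realType.

Lemma normcE (z : R[i]) : `|z| = (normc z)%:C.
Proof. by []. Qed.

Lemma normc_ge0 (z : R[i]) : 0 <= normc z.
Proof. exact: (normr_ge0 (z : Rcomplex R)). Qed.

Lemma normcM (x y : R[i]) : normc (x * y) = normc x * normc y.
Proof. exact: ComplexField.Normc.normcM. Qed.

Lemma normcX (z : R[i]) n : normc (z ^+ n) = normc z ^+ n.
Proof.
elim: n => [|n IH]; first by rewrite !expr0 ComplexField.Normc.normc1.
by rewrite !exprS normcM IH.
Qed.

Lemma ler_normc_sum (I : Type) (r : seq I) (P : pred I) (F : I -> R[i]) :
  normc (\sum_(i <- r | P i) F i) <= \sum_(i <- r | P i) normc (F i).
Proof. exact: (ler_norm_sum r (F : I -> Rcomplex R)). Qed.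

Lemma ler_Re_normc (z : R[i]) : `|complex.Re z| <= normc z.
Proof. by have := normc_ge_Re z; rewrite normcE lecR. Qed.

Lemma ler_Im_normc (z : R[i]) : `|complex.Im z| <= normc z.
Proof.
by case: z => x y /=; rewrite -sqrtr_sqr ler_wsqrtr// lerDr sqr_ge0.
Qed.

Lemma ler_normc_ReIm (z : R[i]) :
  normc z <= `|complex.Re z| + `|complex.Im z|.
Proof.
case: z => x y.
have -> : x +i* y = (x +i* 0) + (0 +i* y).
  by apply/eqP; rewrite eq_complex/= addr0 add0r !eqxx.
apply: le_trans (le_normcD _ _) _.
by rewrite /= !expr0n/= !(addr0, add0r) !sqrtr_sqr.
Qed.

(** The quantity maximized in [mxnorm1]. Columns are tracked one by one because each factor P^(k)
    selects a single column. *)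
Definition colnorm m n (A : 'M[R[i]]_(m, n)) (c : 'I_n) : R :=
  \sum_r normc (A r c).

Lemma colnorm_ge0 m n (A : 'M[R[i]]_(m, n)) c : 0 <= colnorm A c.
Proof. by apply: sumr_ge0 => r _; exact: normc_ge0. Qed.

Lemma colnorm_le_mxnorm1 m n (A : 'M[R[i]]_(m, n)) c : colnorm A c <= mxnorm1 A.
Proof. exact: (le_bigmax _ (fun c => colnorm A c)). Qed.

Lemma mxnorm1_cV m (x : 'cV[R[i]]_m) : mxnorm1 x = colnorm x 0.
Proof.
rewrite /mxnorm1 big_ord_recl big_ord0.
by apply/max_idPl; exact: colnorm_ge0.
Qed.

Lemma normc_le_mxnorm1 m (x : 'cV[R[i]]_m) i : normc (x i 0) <= mxnorm1 x.
Proof.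
rewrite mxnorm1_cV /colnorm (bigD1 i)//= lerDl.
by apply: sumr_ge0 => r _; exact: normc_ge0.
Qed.

Lemma mxnorm1_cV_ge0 m (x : 'cV[R[i]]_m) : 0 <= mxnorm1 x.
Proof. by rewrite mxnorm1_cV colnorm_ge0. Qed.

Lemma colnorm0 m n c : colnorm (0 : 'M[R[i]]_(m, n)) c = 0.
Proof. by apply: big1 => r _; rewrite mxE ComplexField.Normc.normc0. Qed.

Lemma colnorm_sum m n (I : Type) (r : seq I) (P : pred I)
    (F : I -> 'M[R[i]]_(m, n)) c :
  colnorm (\sum_(i <- r | P i) F i) c <= \sum_(i <- r | P i) colnorm (F i) c.
Proof.
rewrite /colnorm exchange_big/=; apply: ler_sum => j _.
by rewrite summxE; exact: ler_normc_sum.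
Qed.

Lemma colnorm_mulmx m n p (A : 'M[R[i]]_(m, n)) (B : 'M[R[i]]_(n, p)) c :
  colnorm (A *m B) c <= \sum_r colnorm A r * normc (B r c).
Proof.
rewrite /colnorm; under [leRHS]eq_bigr do rewrite mulr_suml.
rewrite exchange_big/=; apply: ler_sum => j _.
rewrite mxE; apply: le_trans (ler_normc_sum _ _ _) _.
by apply: ler_sum => l _; rewrite normcM.
Qed.

(** Right multiplication by e_k e_k^T keeps column k and kills the others, so only k = c survives in
    column c of the recursion for F. *)
Lemma colnorm_mul_Pmx m n (A : 'M[R[i]]_(m, n)) k c :
  colnorm (A *m Pmx R k) c = if k == c then colnorm A c else 0.
Proof.
rewrite /colnorm /Pmx.
have E r : (A *m delta_mx k k) r c = A r k * (c == k)%:R.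
  rewrite mxE (bigD1 k)//= big1 ?addr0 => [|l /negbTE lk].
    by rewrite mxE eqxx.
  by rewrite mxE lk mulr0.
case: eqVneq => [kc|ck] /=.
  by apply: eq_bigr => r _; rewrite E kc eqxx mulr1.
apply: big1 => r _.
by rewrite E eq_sym (negbTE ck) mulr0 ComplexField.Normc.normc0.
Qed.

End ColumnNorm.

(** * Iterates of the contractions and of the functional equation *)

Section Iteration.
Variables (R : realType) (N : nat).
Variables (alpha : 'I_N -> R[i] -> R[i]) (H : R[i] -> 'M[R[i]]_N).
Implicit Types (i : {ffun 'I_N -> nat}) (n : nat) (s : R[i]).
Hypothesis alpha_Re : forall k s, 0 <= complex.Re s -> 0 <= complex.Re (alpha k s).
Hypothesis alphaC : forall k l s, 0 <= complex.Re s ->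
  alpha k (alpha l s) = alpha l (alpha k s).

Lemma iter_alpha_Re k n s : 0 <= complex.Re s ->
  0 <= complex.Re (iter n (alpha k) s).
Proof. by move=> s0; elim: n => //= n; exact: alpha_Re. Qed.

Lemma iter_alphaC k l n s : 0 <= complex.Re s ->
  iter n (alpha l) (alpha k s) = alpha k (iter n (alpha l) s).
Proof.
move=> s0; elim: n => //= n ->.
by apply: alphaC; exact: iter_alpha_Re.
Qed.

Lemma foldr_alpha_Re i (t : seq 'I_N) s : 0 <= complex.Re s ->
  0 <= complex.Re (foldr (fun k z => iter (i k) (alpha k) z) s t).
Proof. by move=> s0; elim: t => //= l t; exact: iter_alpha_Re. Qed.

Lemma malpha_Re i s : 0 <= complex.Re s -> 0 <= complex.Re (malpha alpha i s).
Proof. exact: foldr_alpha_Re. Qed.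

Lemma malpha0 s : malpha alpha [ffun=> 0%N] s = s.
Proof. by rewrite /malpha; elim: (enum _) => //= l t ->; rewrite ffunE. Qed.

(** By commutativity one copy of alpha_k can be pulled out of its place in the composition to the
    outermost position. *)
Lemma malpha_mdecr i k s : 0 <= complex.Re s -> i k != 0%N ->
  malpha alpha i s = alpha k (malpha alpha (mdecr i k) s).
Proof.
move=> s0 ik; rewrite /malpha.
have : k \in enum 'I_N by rewrite mem_enum.
have : uniq (enum 'I_N) by rewrite enum_uniq.
elim: (enum 'I_N) => //= l t IH /andP[lt ut]; rewrite inE => /orP[/eqP kl|kt].
  (* At the place of k one iterate is split off. Since k does not occur again in the list,
     decrementing i_k leaves the inner maps unchanged. *)
  rewrite -{l}kl in lt *; rewrite ffunE eqxx.
  rewrite -[in LHS](prednK (n := i k)) ?lt0n// iterS; congr (alpha k (iter _ _ _)).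
  elim: t lt {IH ut} => //= l t IH; rewrite inE negb_or => /andP[kl kt].
  by rewrite IH// ffunE eq_sym (negbTE kl).
(* Here k lies further inside, and the alpha_k supplied by the induction hypothesis moves outward
   past the iterates of alpha_l. *)
rewrite IH// ffunE; have -> : (l == k) = false.
  by apply: contraNF lt => /eqP ->.
by rewrite iter_alphaC//; exact: foldr_alpha_Re.
Qed.

(** Each of the |i| maps applied fixes a and shrinks the distance to it by kappa. *)
Lemma malpha_contract (kappa : R) (a : R[i]) i s :
  0 <= kappa ->
  (forall k s u, 0 <= complex.Re s -> 0 <= complex.Re u ->
     normc (alpha k s - alpha k u) <= kappa * normc (s - u)) ->
  0 <= complex.Re a -> (forall k, alpha k a = a) -> 0 <= complex.Re s ->
  normc (malpha alpha i s - a) <= kappa ^+ mdeg i * normc (s - a).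
Proof.
move=> k0 contr a0 fix_a s0.
have [n iN] : exists n, mdeg i = n by exists (mdeg i).
rewrite iN; elim: n i iN => [|n IH] i iN.
  have -> : i = [ffun=> 0%N].
    by apply/ffunP => l; rewrite ffunE; apply/eqP; rewrite -leqn0 -iN le_mdeg.
  by rewrite malpha0 expr0 mul1r.
have [k ik] := mdegS_exists iN.
rewrite (malpha_mdecr s0 ik) -{1}(fix_a k) exprS -mulrA.
apply: le_trans (contr _ _ _ (malpha_Re _ s0) a0) _.
by rewrite ler_wpM2l// IH//; exact: mdeg_mdecr iN.
Qed.

(** The right-hand side contains the homogeneous part of the functional equation at alpha_j(s); for
    X = Z it can be replaced by Z - V there. *)
Lemma sum_mdeg_FmxS (X : R[i] -> 'cV[R[i]]_N) n s : 0 <= complex.Re s ->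
  sum_mdeg n.+1 (fun i => Fmx alpha H i s *m X (malpha alpha i s)) =
  sum_mdeg n (fun j => Fmx alpha H j s *m (H (malpha alpha j s) *m
    \sum_k Pmx R k *m X (alpha k (malpha alpha j s)))).
Proof.
move=> s0.
pose G k j := Fmx alpha H j s *m H (malpha alpha j s) *m Pmx R k
                *m X (alpha k (malpha alpha j s)).
transitivity (sum_mdeg n.+1
    (fun i => \sum_k (if i k == 0%N then 0 else G k (mdecr i k)))).
  apply: eq_sum_mdeg => i iN; rewrite FmxE ?iN// mulmx_suml.
  apply: eq_bigr => k _; case: ifPn => [|ik]; first by rewrite mul0mx.
  by rewrite (malpha_mdecr s0 ik).
rewrite sum_mdegS; apply: eq_sum_mdeg => j _.
rewrite mulmx_sumr mulmx_sumr; apply: eq_bigr => k _.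
by rewrite /G !mulmxA.
Qed.

(** Column c receives only the term k = c of the recursion, so each j contributes once and no factor
    N is lost per step. *)
Lemma sum_mdeg_colnorm_FmxS n s c :
  sum_mdeg n.+1 (fun i => colnorm (Fmx alpha H i s) c) <=
  sum_mdeg n (fun j => colnorm (Fmx alpha H j s *m H (malpha alpha j s)) c).
Proof.
pose G k j := Fmx alpha H j s *m H (malpha alpha j s) *m Pmx R k.
apply: (@le_trans _ _ (sum_mdeg n.+1 (fun i =>
    \sum_k (if i k == 0%N then 0 else colnorm (G k (mdecr i k)) c)))).
  apply: ler_sum_mdeg => i iN; rewrite FmxE ?iN//.
  apply: le_trans (colnorm_sum _ _ _ _) _; apply: ler_sum => k _.
  by case: ifP => // _; rewrite colnorm0.
rewrite (sum_mdegS _ (fun k j => colnorm (G k j) c)).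
apply: ler_sum_mdeg => j _.
under eq_bigr do rewrite colnorm_mul_Pmx.
by rewrite -big_mkcond/= big_pred1_eq.
Qed.

(** Substituting the functional equation at every alpha_i(s) with |i| = n splits the remainder into
    the degree n term of the series and the remainder of degree n+1. *)
Lemma iterate_equation (Z V : R[i] -> 'cV[R[i]]_N) n s :
  (forall s, 0 <= complex.Re s ->
    Z s = H s *m (\sum_k Pmx R k *m Z (alpha k s)) + V s) ->
  0 <= complex.Re s ->
  Z s = \sum_(k < n) sum_mdeg k (fun i => Fmx alpha H i s *m V (malpha alpha i s))
        + sum_mdeg n (fun i => Fmx alpha H i s *m Z (malpha alpha i s)).
Proof.
move=> hZ s0; elim: n => [|n IH].
  by rewrite big_ord0 add0r sum_mdeg0 Fmx0 mul1mx malpha0.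
rewrite {1}IH big_ord_recr/= -addrA; congr (_ + _).
rewrite (sum_mdeg_FmxS _ _ s0) -sum_mdegD; apply: eq_sum_mdeg => i _.
by rewrite {1}hZ ?malpha_Re// mulmxDr addrC.
Qed.

End Iteration.

(** * Complex limits and local Lipschitz bounds for analytic functions *)

Section ComplexSequences.
Variable R : realType.

Lemma cvg_normcP (u : nat -> R[i]^o) (l : R[i]^o) :
  u @ \oo --> l <->
  forall e : R, 0 < e -> \forall n \near \oo, normc (l - u n) < e.
Proof.
split=> [/cvgrPdist_lt h e e0|h].
  have := h e%:C; rewrite ltcR => /(_ e0).
  by apply: filterS => n; rewrite normcE ltcR.
apply/cvgrPdist_lt => e e0.
(* A positive element of [R[i]] is real, so real tolerances suffice. *)
have eE : e = (complex.Re e)%:C by rewrite RRe_real// gtr0_real.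
move: e0; rewrite eE ltcR => /h.
by apply: filterS => n; rewrite normcE ltcR.
Qed.

Lemma cvg_cV_ReIm N (u : nat -> 'cV[R[i]^o]_N) (l : 'cV[R[i]^o]_N) :
  (forall i, complex.Re (u n i 0) @[n --> \oo] --> complex.Re (l i 0)) ->
  (forall i, complex.Im (u n i 0) @[n --> \oo] --> complex.Im (l i 0)) ->
  u @ \oo --> l.
Proof.
move=> hRe hIm.
have huv i : (fun n => u n i 0) @ \oo --> l i 0.
  apply/cvg_normcP => e e0.
  have e20 : 0 < e / 2 by rewrite divr_gt0.
  move/cvgrPdist_lt : (hRe i) => /(_ _ e20) hR.
  move/cvgrPdist_lt : (hIm i) => /(_ _ e20) hI.
  near=> n.
  apply: le_lt_trans (ler_normc_ReIm _) _.
  rewrite [e]splitr; apply: ltrD.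
    rewrite (raddfB (@complex.Re R : Rcomplex R -> R)).
    by near: n.
  rewrite (raddfB (@complex.Im R : Rcomplex R -> R)).
  by near: n.
apply/cvg_mx_entourageP => A entA.
have : \forall n \near \oo, forall i, (l i 0, u n i 0) \in A.
  apply: filter_forall => i.
  have /cvg_entourageP/(_ A entA) := huv i.
  rewrite near_map; apply: filterS => n An; exact/mem_set.
by apply: filterS => n h i j; rewrite (ord1 j).
Unshelve. all: by end_near. Qed.

(** Convergence at distance r/2 bounds c_n (r/2)^n by some M. Within r/4 of the centre, the power
    series without its constant term is then dominated by a geometric series of ratio 1/2. *)
Lemma analytic_at_lipschitz (f : R[i] -> R[i]) (z0 : R[i]) :
  analytic_at f z0 ->
  exists L r : R, [/\ 0 <= L, 0 < r &
    forall z, normc (z - z0) < r -> normc (f z - f z0) <= L * normc (z - z0)].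
Proof.
move=> [c [r [r0 hf]]].
have r20 : 0 < r / 2 by rewrite divr_gt0.
have normcR (x : R) : 0 <= x -> normc x%:C = x.
  by move=> x0; rewrite /= expr0n/= addr0 sqrtr_sqr ger0_norm.
(* The terms of the series at z0 + r/2 tend to 0: they are at most 1 from index m on, and [S] covers
   the earlier ones. *)
have [M [M0 hM]] : exists M : R, 0 <= M /\
    forall n, normc (c n) * (r / 2) ^+ n <= M.
  have : `|z0 + (r / 2)%:C - z0| < r%:C.
    rewrite addrAC subrr add0r normcE normcR ?(ltW r20)// ltcR.
    by rewrite ltr_pdivrMr// mulr_natr mulr2n ltrDl.
  move=> /hf; rewrite addrAC subrr add0r => /cvgP /cvg_series_cvg_0 h.
  have /cvg_normcP/(_ 1 ltr01) [m _ hm] := h.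
  have nE n : normc (c n) * (r / 2) ^+ n = normc (c n * (r / 2)%:C ^+ n).
    by rewrite normcM normcX normcR// ltW.
  pose S := \sum_(k < m) normc (c k) * (r / 2) ^+ k.
  have S0 : 0 <= S.
    by apply: sumr_ge0 => k _; rewrite mulr_ge0 ?normc_ge0// exprn_ge0// ltW.
  exists (1 + S); split; first by rewrite addr_ge0.
  move=> n; have [nm|mn] := ltnP n m.
    apply: (@le_trans _ _ S); last by rewrite lerDr.
    rewrite /S (bigD1 (Ordinal nm))//= lerDl.
    by apply: sumr_ge0 => k _; rewrite mulr_ge0 ?normc_ge0// exprn_ge0// ltW.
  have := hm n mn; rewrite /= sub0r normcN -nE => /ltW h1.
  by apply: le_trans h1 _; rewrite lerDl.
(* Stated with [c 0] in place of [f z0]; their equality follows afterwards by taking z = z0. *)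
have key z : normc (z - z0) < r / 4 ->
    normc (f z - c 0%N) <= (4 / r * M) * normc (z - z0).
  move=> zr; set t := normc (z - z0) in zr *.
  have t0 : 0 <= t by exact: normc_ge0.
  have zr' : `|z - z0| < r%:C.
    by rewrite normcE ltcR -/t; lra.
  have /cvg_normcP hz := hf _ zr'.
  apply/ler_addgt0Pr => e e0.
  have [m _ hm] := hz e e0.
  (* With m+1 terms, removing the constant one leaves a sum over k < m of the terms of index k+1. *)
  have {hm} := hm m.+1 (leqnSn m) => /= /ltW hm.
  set S := series _ _ in hm.
  have -> : f z - c 0%N = (S - c 0%N) + (f z - S) by ring.
  apply: le_trans (le_normcD _ _) _; apply: lerD => //.
  have -> : S - c 0%N = \sum_(k < m) c k.+1 * (z - z0) ^+ k.+1.
    rewrite /S /series/= big_mkord big_ord_recl/= expr0 mulr1 addrAC subrr add0r.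
    by apply: eq_bigr => k _.
  apply: le_trans (ler_normc_sum _ _ _) _.
  (* The ratio to the radius r/2; it is at most 1/2 because t < r/4. *)
  pose q := t / (r / 2).
  have q0 : 0 <= q by rewrite divr_ge0// ltW.
  have q2 : q <= 1 / 2 by rewrite ler_pdivrMr//; lra.
  apply: (@le_trans _ _ (\sum_(k < m) M * (q * (1 / 2) ^+ k))).
    apply: ler_sum => k _.
    have -> : normc (c k.+1 * (z - z0) ^+ k.+1) =
        (normc (c k.+1) * (r / 2) ^+ k.+1) * q ^+ k.+1.
      rewrite normcM -mulrA -exprMn mulrC [in RHS]mulrC; congr (_ * _).
      rewrite [r / 2 * q]mulrC /q divfK ?gt_eqF// /t.
      by rewrite normcX.
    apply: ler_pM => //.
    - by rewrite mulr_ge0 ?normc_ge0// exprn_ge0// ltW.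
    - by rewrite exprn_ge0.
    - by rewrite exprS ler_wpM2l// lerXn2r// nnegrE; lra.
  rewrite -mulr_sumr -mulr_sumr.
  have -> : 4 / r * M * t = M * (q * 2).
    by rewrite /q; field; rewrite gt_eqF.
  rewrite ler_wpM2l// ler_wpM2l//.
  suff -> : \sum_(k < m) (1 / 2) ^+ k = 2 - 2 * (1 / 2) ^+ m :> R.
    by rewrite lerBlDr lerDl mulr_ge0// exprn_ge0//; lra.
  elim: m {hm S} => [|p IH]; first by rewrite big_ord0 expr0; lra.
  by rewrite big_ord_recr/= IH exprS; lra.
have r40 : 0 < r / 4 by rewrite divr_gt0.
have f0 : f z0 = c 0%N.
  apply/eqP; rewrite -subr_eq0; apply/eqP/ComplexField.Normc.eq0_normc.
  apply/eqP; rewrite eq_le normc_ge0 andbT.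
  have := key z0; rewrite subrr ComplexField.Normc.normc0 mulr0; exact.
exists (4 / r * M), (r / 4); split => //; first by rewrite mulr_ge0// divr_ge0// ltW.
by move=> z /key; rewrite f0.
Qed.

End ComplexSequences.

(** * Lipschitz continuity of the Laplace-Stieltjes transform *)

Section LaplaceTransform.
Variable R : realType.

Lemma lipschitz1_of_derive (f df : R -> R) (x y : R) :
  (forall z : R, is_derive z (1 : R) f (df z)) -> (forall z, `|df z| <= 1) ->
  `|f x - f y| <= `|x - y|.
Proof.
move=> hf hdf; wlog xy : x y / x <= y.
  move=> h; have [/h//|/ltW/h] := leP x y.
  by rewrite distrC [leRHS]distrC.
have [c _ E] : exists2 c, c \in `[x, y] & f y - f x = df c * (y - x).
  apply: MVT_segment => //.
  apply: continuous_subspaceT => z; apply: differentiable_continuous.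
  exact/derivable1_diffP/ex_derive.
by rewrite distrC E normrM [leRHS]distrC ler_piMl.
Qed.

Lemma ler_dist_cos (x y : R) : `|cos x - cos y| <= `|x - y|.
Proof.
apply: (@lipschitz1_of_derive _ (fun z => - sin z)) => z.
by rewrite normrN; exact: sin_max.
Qed.

Lemma ler_dist_sin (x y : R) : `|sin x - sin y| <= `|x - y|.
Proof. by apply: (@lipschitz1_of_derive _ cos) => z; exact: cos_max. Qed.

(** For x <= y, factor out exp(-x) <= 1 and apply 1 + t <= exp t at t = x - y. *)
Lemma ler_dist_expRN (x y : R) : 0 <= x -> 0 <= y ->
  `|expR (- x) - expR (- y)| <= `|x - y|.
Proof.
wlog xy : x y / x <= y.
  move=> h x0 y0; have [xy|/ltW yx] := leP x y; first exact: h.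
  by rewrite distrC [leRHS]distrC h.
move=> x0 y0.
rewrite ger0_norm; last by rewrite subr_ge0 ler_expR lerN2.
rewrite distrC ger0_norm ?subr_ge0//.
have -> : - y = - x + (x - y) by ring.
rewrite expRD -[X in X - _]mulr1 -mulrBr.
apply: (@le_trans _ _ (1 * (1 - expR (x - y)))).
  rewrite ler_wpM2r//; last by rewrite -expR0 ler_expR oppr_le0.
  by rewrite subr_ge0 -expR0 ler_expR; lra.
by have := expR_ge1Dx (x - y); lra.
Qed.

Lemma ler_distM_bounded (p q p' q' : R) :
  `|q| <= 1 -> `|p'| <= 1 -> `|p * q - p' * q'| <= `|p - p'| + `|q - q'|.
Proof.
move=> q1 p1.
have -> : p * q - p' * q' = (p - p') * q + p' * (q - q') by ring.
apply: le_trans (ler_normD _ _) _; rewrite !normrM.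
by apply: lerD; [rewrite ler_piMr|rewrite ler_piMl].
Qed.

Section Expectation.
Context d (T : measurableType d) (P : probability T R).

Lemma bounded_integrable1 (f : T -> R) : measurable_fun setT f ->
  (forall w, `|f w| <= 1) -> P.-integrable setT (EFin \o f).
Proof.
move=> mf f1; apply: measurable_bounded_integrable => //.
  exact: fin_num_fun_lty.
exists 1; split => // M M1 w _; exact: le_trans (f1 w) (ltW M1).
Qed.

(** Boundedness makes [f] and [g] integrable, so [fine] meets only finite values, and the integral
    of |f - g| is dominated by that of C W. *)
Lemma expectation_lipschitz (W : {RV P >-> R}) (f g : T -> R) (C : R) :
  (forall w, 0 <= W w) -> ('E_P[W] < +oo)%E ->
  measurable_fun setT f -> measurable_fun setT g ->
  (forall w, `|f w| <= 1) -> (forall w, `|g w| <= 1) ->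
  (forall w, `|f w - g w| <= C * W w) ->
  `|fine 'E_P[f] - fine 'E_P[g]| <= C * fine 'E_P[W].
Proof.
move=> W0 EW mf mg f1 g1 fgW; rewrite unlock in EW *.
have intf := bounded_integrable1 mf f1.
have intg := bounded_integrable1 mg g1.
have intW : P.-integrable setT (EFin \o W).
  apply/integrableP; split; first exact/measurable_EFinP.
  by under eq_integral do rewrite /= ger0_norm//.
have -> : fine (\int[P]_w (f w)%:E) - fine (\int[P]_w (g w)%:E) =
    \int[P]_(w in setT) (f w - g w) by rewrite RintegralB.
have -> : C * fine (\int[P]_w (W w)%:E) = \int[P]_(w in setT) (C * W w).
  by rewrite RintegralZl.
have intfg : P.-integrable setT (EFin \o (fun w => f w - g w)).
  exact: (integrableB _ intf intg).
apply: le_trans (le_normr_Rintegral _ intfg) _ => //.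
apply: le_Rintegral => //; first exact: integrable_norm.
exact: (integrableZl _ C intW).
Qed.

End Expectation.

(** On the right half-plane s -> exp(-sW) is Lipschitz with constant proportional to W, and the
    finite mean of W carries this over to the expectation. *)
Lemma jointLST_lipschitz d (T : measurableType d) (P : probability T R) N
    (W : {RV P >-> R}) (Y : T -> 'I_N) :
  (forall w, 0 <= W w) -> (forall i, measurable (Y @^-1` [set i])) ->
  ('E_P[W] < +oo)%E ->
  exists L : R, 0 <= L /\ forall s u : R[i],
    0 <= complex.Re s -> 0 <= complex.Re u ->
    mxnorm1 (jointLST P W Y s - jointLST P W Y u) <= L * normc (s - u).
Proof.
move=> W0 mY EW.
(* Taking [t] to be [cos] or [sin] gives the real or the imaginary part, so one estimate serves
   both. *)
pose fRe (t : R -> R) (s : R[i]) i w :=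
  expR (- (complex.Re s * W w)) * t (- (complex.Im s * W w)) * (Y w == i)%:R.
have mf t s i : measurable_fun setT t -> measurable_fun setT (fRe t s i).
  move=> mt; apply: measurable_funM.
    apply: measurable_funM; apply: measurableT_comp => //.
      by apply: measurableT_comp => //; exact: measurable_funM.
    by apply: measurableT_comp => //; exact: measurable_funM.
  rewrite (_ : (fun w => _) = \1_(Y @^-1` [set i]) :> (T -> R)).
    exact: measurable_indic.
  apply/funext => w; rewrite indicE; congr (_%:R); congr nat_of_bool.
  by apply/eqP/idP => [h|]; rewrite inE.
have f1 t s i w : (forall x, `|t x| <= 1) -> 0 <= complex.Re s ->
    `|fRe t s i w| <= 1.
  move=> t1 s0; rewrite /fRe !normrM.
  rewrite mulr_ile1 ?mulr_ge0// ?mulr_ile1//.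
    by rewrite ger0_norm ?expR_ge0// -expR0 ler_expR oppr_le0 mulr_ge0.
  by case: eqP => _; rewrite ?normr1 ?normr0.
have fL t s u i w : (forall x, `|t x| <= 1) ->
    (forall x y, `|t x - t y| <= `|x - y|) ->
    0 <= complex.Re s -> 0 <= complex.Re u ->
    `|fRe t s i w - fRe t u i w| <= (2 * normc (s - u)) * W w.
  move=> t1 tL s0 u0; rewrite /fRe -mulrBl normrM.
  apply: (@le_trans _ _ (`|expR (- (complex.Re s * W w))
      * t (- (complex.Im s * W w)) - expR (- (complex.Re u * W w))
      * t (- (complex.Im u * W w))|)).
    by rewrite ler_piMr//; case: eqP => _; rewrite ?normr1 ?normr0.
  apply: le_trans; first apply: ler_distM_bounded => //.
    by rewrite ger0_norm ?expR_ge0// -expR0 ler_expR oppr_le0 mulr_ge0.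
  have hR : `|complex.Re s - complex.Re u| <= normc (s - u).
    by have := ler_Re_normc (s - u); rewrite (raddfB (@complex.Re R : Rcomplex R -> R)).
  have hI : `|complex.Im s - complex.Im u| <= normc (s - u).
    by have := ler_Im_normc (s - u); rewrite (raddfB (@complex.Im R : Rcomplex R -> R)).
  rewrite mulr_natl mulr2n mulrDl; apply: lerD.
    apply: le_trans (ler_dist_expRN _ _) _; rewrite ?mulr_ge0//.
    by rewrite -mulrBl normrM (ger0_norm (W0 w)) ler_wpM2r.
  apply: le_trans (tL _ _) _.
  by rewrite -opprD normrN -mulrBl normrM (ger0_norm (W0 w)) ler_wpM2r.
have LSTE s i : jointLST P W Y s i 0 =
    fine 'E_P[fRe (@cos R) s i] +i* fine 'E_P[fRe (@sin R) s i].
  rewrite mxE /cexpectation.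
  congr (fine 'E_P[_] +i* fine 'E_P[_]); apply/funext => w; rewrite /fRe.
    case: (Y w == i); rewrite ?mulr1 ?mulr0//.
    by case: s => x y /=; rewrite !mulr0 subr0 add0r !mulNr.
  case: (Y w == i); rewrite ?mulr1 ?mulr0//.
  by case: s => x y /=; rewrite !mulr0 subr0 add0r !mulNr.
pose e := fine 'E_P[W].
have e0 : 0 <= e by rewrite fine_ge0// expectation_ge0.
(* The exponential and the trigonometric factor each contribute |s - u| W, which gives 2; real and
   imaginary parts double it, and there are N components. *)
exists (N%:R * (4 * e)); split; first by rewrite !mulr_ge0.
move=> s u s0 u0; rewrite mxnorm1_cV /colnorm.
apply: (@le_trans _ _ (\sum_(r < N) 4 * e * normc (s - u))); last first.
  by rewrite sumr_const card_ord -[leLHS]mulr_natl !mulrA.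
apply: ler_sum => i _; apply: le_trans (ler_normc_ReIm _) _.
have -> : (jointLST P W Y s - jointLST P W Y u) i 0 =
    jointLST P W Y s i 0 - jointLST P W Y u i 0 by rewrite !mxE.
rewrite !LSTE /=.
have -> : 4 * e * normc (s - u) =
    2 * normc (s - u) * e + 2 * normc (s - u) * e by ring.
have mcos : measurable_fun setT (@cos R).
  by apply: continuous_measurable_fun; exact: continuous_cos.
have msin : measurable_fun setT (@sin R).
  by apply: continuous_measurable_fun; exact: continuous_sin.
have h (t : R -> R) : measurable_fun setT t -> (forall x, `|t x| <= 1) ->
    (forall x y, `|t x - t y| <= `|x - y|) ->
    `|fine 'E_P[fRe t s i] - fine 'E_P[fRe t u i]| <= 2 * normc (s - u) * e.
  move=> mt t1 tL; apply: (expectation_lipschitz W0 EW).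
  - exact: mf.
  - exact: mf.
  - by move=> w; exact: f1.
  - by move=> w; exact: f1.
  - by move=> w; exact: fL.
apply: lerD; apply: h => //.
- exact: cos_max.
- exact: ler_dist_cos.
- exact: sin_max.
- exact: ler_dist_sin.
Qed.

End LaplaceTransform.

(* Over an abstract field [K]: with [R[i]] in place of [K], unifying the
   structures of ['cV[R[i]^o]_N] does not terminate in reasonable time. *)
Section ColumnLimits.
Variables (K : numFieldType) (N : nat).

(** Here [v] stands for the partial sums of the series and [e] for the error of freezing Z at a; the
    shift reflects that the tail starts at degree n+1. *)
Lemma cvg_remainder_cV (u v e : nat -> 'cV[K^o]_N) (z l : 'cV[K^o]_N) :
  v @ \oo --> l -> e @ \oo --> (0 : 'cV[K^o]_N) ->
  (forall n, u n = z - v n.+1 - e n) -> u @ \oo --> z - l.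
Proof.
move=> vl e0 uE; rewrite (funext uE) -[X in _ --> X]subr0.
apply: (@cvgB K 'cV[K^o]_N) => //; apply: cvgB; first exact: cvg_cst.
by rewrite cvg_shiftS.
Qed.

Lemma lim_cV (u : nat -> 'cV[K^o]_N) (l : 'cV[K^o]_N) :
  u @ \oo --> l -> limn u = l.
Proof. by move=> ul; apply: cvg_lim => //; exact: norm_hausdorff. Qed.

End ColumnLimits.

(** * Geometric bounds and absolute convergence *)

Section VectorSequences.
Variable R : realType.

(** The finitely many terms before the bound takes effect are absorbed by adding all their ratios
    |u_k| / q^k to the constant. *)
Lemma geometric_bound (u : nat -> R) (q K : R) : 0 < q ->
  (\forall n \near \oo, u n <= K * q ^+ n) ->
  exists2 C, 0 <= C & forall n, u n <= C * q ^+ n.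
Proof.
move=> q0 [m _ hm].
have S0 : 0 <= \sum_(k < m) `|u k| / q ^+ k.
  by apply: sumr_ge0 => k _; rewrite divr_ge0// exprn_ge0// ltW.
exists (`|K| + \sum_(k < m) `|u k| / q ^+ k); first by rewrite addr_ge0.
move=> n; have qn : 0 < q ^+ n by rewrite exprn_gt0.
have [nm|mn] := ltnP n m.
  rewrite mulrDl; apply: (@le_trans _ _ (`|u n| / q ^+ n * q ^+ n)).
    by rewrite divfK ?gt_eqF// ler_norm.
  apply: (@le_trans _ _ ((\sum_(k < m) `|u k| / q ^+ k) * q ^+ n)).
    rewrite ler_wpM2r// ?(ltW qn)// (bigD1 (Ordinal nm))//= lerDl.
    by apply: sumr_ge0 => k _; rewrite divr_ge0// exprn_ge0// ltW.
  by rewrite lerDr mulr_ge0// ltW.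
apply: le_trans (hm n mn) _; rewrite ler_wpM2r// ?(ltW qn)//.
by apply: le_trans (ler_norm _) _; rewrite lerDl.
Qed.

Lemma is_cvg_series_geometric_bound (u : nat -> R) (q C : R) :
  0 <= q < 1 -> (forall n, 0 <= u n <= C * q ^+ n) -> cvgn (series u).
Proof.
move=> /andP[q0 q1] hu; apply: (@series_le_cvg _ _ (geometric C q)).
- by move=> n; have /andP[] := hu n.
- by move=> n; have /andP[/le_trans] := hu n; apply.
- by move=> n; have /andP[] := hu n.
- by apply: is_cvg_geometric_series; rewrite ger0_norm.
Qed.

Lemma cvg_mulr_expr0 (q C : R) : 0 <= q < 1 -> C * q ^+ n @[n --> \oo] --> 0.
Proof.
move=> /andP[q0 q1]; rewrite -[X in _ --> X](mulr0 C).
by apply: cvgMr; apply: cvg_expr; rewrite ger0_norm.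
Qed.

Lemma cvg_cV0_mxnorm1 N (u : nat -> 'cV[R[i]^o]_N) (e : nat -> R) :
  (forall n, mxnorm1 (u n : 'cV[R[i]]_N) <= e n) -> e @ \oo --> 0 ->
  u @ \oo --> (0 : 'cV[R[i]^o]_N).
Proof.
move=> ue e0.
have h (f : nat -> R) : (forall n, `|f n| <= e n) -> f @ \oo --> 0.
  move=> fe; apply/norm_cvg0P.
  apply: (@squeeze_cvgr _ _ _ _ (cst 0) e) => //; last exact: cvg_cst.
  by near=> n; rewrite /= normr_ge0/=; exact: fe.
apply: cvg_cV_ReIm => j; rewrite mxE; apply: h => n.
  by apply: le_trans (ler_Re_normc _) _; apply: le_trans (ue n);
     exact: normc_le_mxnorm1.
by apply: le_trans (ler_Im_normc _) _; apply: le_trans (ue n);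
   exact: normc_le_mxnorm1.
Unshelve. all: by end_near. Qed.

(** Real and imaginary parts of the entries are dominated by the 1-norm, so each gives an absolutely
    convergent real series. *)
Lemma is_cvg_series_mxnorm1 N (u : nat -> 'cV[R[i]^o]_N) :
  cvgn (series (fun n => mxnorm1 (u n : 'cV[R[i]]_N))) -> cvgn (series u).
Proof.
move=> cu.
have h (f : nat -> R) : (forall n, `|f n| <= mxnorm1 (u n : 'cV[R[i]]_N)) ->
    cvgn (series f).
  move=> fe; apply: normed_cvg; apply: series_le_cvg cu => //= n.
  exact: mxnorm1_cV_ge0.
pose re j n := complex.Re (u n j 0).
pose im j n := complex.Im (u n j 0).
have cre j : cvgn (series (re j)).
  apply: h => n; apply: le_trans (ler_Re_normc _) _.
  exact: normc_le_mxnorm1.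
have cim j : cvgn (series (im j)).
  apply: h => n; apply: le_trans (ler_Im_normc _) _.
  exact: normc_le_mxnorm1.
apply/cvg_ex; exists (\col_j (limn (series (re j)) +i* limn (series (im j)))).
apply: cvg_cV_ReIm => j; rewrite mxE /=.
  rewrite (_ : (fun n => _) = series (re j)); first exact: cre.
  apply/funext => n; rewrite /series/= summxE.
  exact: (raddf_sum (@complex.Re R : Rcomplex R -> R)).
rewrite (_ : (fun n => _) = series (im j)); first exact: cim.
apply/funext => n; rewrite /series/= summxE.
exact: (raddf_sum (@complex.Im R : Rcomplex R -> R)).
Qed.

End VectorSequences.

(** * Growth of the matrices F with the degree *)

Section Growth.
Variables (R : realType) (N : nat).
Variables (alpha : 'I_N -> R[i] -> R[i]) (H : R[i] -> 'M[R[i]]_N).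

Lemma mxnorm1_sum_mdeg n (f : {ffun 'I_N -> nat} -> 'cV[R[i]]_N) :
  mxnorm1 (sum_mdeg n f) <= sum_mdeg n (fun i => mxnorm1 (f i)).
Proof.
rewrite mxnorm1_cV /sum_mdeg; apply: le_trans (colnorm_sum _ _ _ _) _.
by apply: ler_sum => i _; rewrite mxnorm1_cV.
Qed.

(** [A] bounds the sum for each column separately, whence the factor N. *)
Lemma sum_mdeg_Fmx_le n (X : {ffun 'I_N -> nat} -> 'cV[R[i]]_N) s (A B : R) :
  (forall c, sum_mdeg n (fun i => colnorm (Fmx alpha H i s) c) <= A) ->
  (forall i, mdeg i = n -> mxnorm1 (X i) <= B) -> 0 <= B ->
  sum_mdeg n (fun i => mxnorm1 (Fmx alpha H i s *m X i)) <= N%:R * A * B.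
Proof.
move=> hA hB B0.
apply: (@le_trans _ _ (sum_mdeg n
    (fun i => \sum_c colnorm (Fmx alpha H i s) c * B))).
  apply: ler_sum_mdeg => i iN; rewrite mxnorm1_cV.
  apply: le_trans (colnorm_mulmx _ _ _) _; apply: ler_sum => c _.
  rewrite ler_wpM2l ?colnorm_ge0//.
  by apply: le_trans (normc_le_mxnorm1 _ _) _; exact: hB.
rewrite sum_mdeg_sum.
apply: (@le_trans _ _ (\sum_(c < N) A * B)); last first.
  by rewrite sumr_const card_ord -[leLHS]mulr_natl mulrA.
by apply: ler_sum => c _; rewrite sum_mdegMr ler_wpM2r.
Qed.

(** The entrywise majorant [h] does not depend on i, so one can sum over |i| = n before bounding
    uniformly in the column. One step then costs a column sum of [h], hence at most rho. *)
Lemma sum_mdeg_Fmx_growth s (h : 'I_N -> 'I_N -> R) (rho : R) :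
  0 < rho -> (forall r c, 0 <= h r c) -> (forall c, \sum_r h r c <= rho) ->
  (\forall n \near \oo, forall i, mdeg i = n ->
     forall r c, normc (H (malpha alpha i s) r c) <= h r c) ->
  exists2 C, 0 <= C & forall n c,
    sum_mdeg n (fun i => colnorm (Fmx alpha H i s) c) <= C * rho ^+ n.
Proof.
move=> rho0 h0 hrho [m _ hm].
pose Phi n c := sum_mdeg n (fun i => colnorm (Fmx alpha H i s) c).
have Phi0 n c : 0 <= Phi n c.
  by apply: sum_mdeg_ge0 => i; exact: colnorm_ge0.
pose S n := \sum_c Phi n c.
have S0 n : 0 <= S n by exact: sumr_ge0.
(* [S m] serves as a common bound for all columns at the degree m from which the majorant is
   valid. *)
have key n c : Phi (m + n)%N c <= S m * rho ^+ n.
  elim: n c => [|n IH] c.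
    by rewrite addn0 expr0 mulr1 /S (bigD1 c)//= lerDl sumr_ge0.
  rewrite addnS; apply: le_trans (sum_mdeg_colnorm_FmxS _ _ _ _ _) _.
  apply: (@le_trans _ _ (\sum_r Phi (m + n)%N r * h r c)).
    under [leRHS]eq_bigr do rewrite -sum_mdegMr.
    rewrite -sum_mdeg_sum; apply: ler_sum_mdeg => i iN.
    apply: le_trans (colnorm_mulmx _ _ _) _; apply: ler_sum => r _.
    by rewrite ler_wpM2l ?colnorm_ge0//; apply: (hm _ _ _ iN); exact: leq_addr.
  apply: (@le_trans _ _ (\sum_r S m * rho ^+ n * h r c)).
    by apply: ler_sum => r _; rewrite ler_wpM2r.
  rewrite -mulr_sumr exprSr mulrA ler_wpM2l//.
  by rewrite mulr_ge0// exprn_ge0// ltW.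
have : \forall n \near \oo, S n <= (N%:R * (S m / rho ^+ m)) * rho ^+ n.
  exists m => // n /= mn.
  have -> : N%:R * (S m / rho ^+ m) * rho ^+ n = \sum_(c < N) S m * rho ^+ (n - m).
    rewrite sumr_const card_ord -[RHS]mulr_natl -!mulrA; congr (_ * (_ * _)).
    by rewrite -[in LHS](subnKC mn) exprD mulrA mulVf ?mul1r// expf_neq0// gt_eqF.
  by apply: ler_sum => c _; rewrite -{1}(subnKC mn).
move=> /(geometric_bound rho0)[C C0 hC]; exists C => // n c.
by apply: le_trans (hC n); rewrite /S (bigD1 c)//= lerDl sumr_ge0.
Qed.

End Growth.

(** * The series representation of the transform vector *)

Theorem theorem1 (R : realType) (d : measure_display) (T : measurableType d)
  (P : probability T R) (N : nat) (hN : (1 <= N)%N)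
  (W : {RV P >-> R}) (hW : forall w, 0 <= W w)
  (Y : T -> 'I_N) (hY : forall A : set 'I_N, measurable (Y @^-1` A))
  (pit : 'cV[R]_N) (hpit : forall i, P (Y @^-1` [set i]) = (pit i 0)%:E)
  (H : R[i] -> 'M[R[i]]_N) (V : R[i] -> 'cV[R[i]]_N)
  (zeta : R) (hzeta : 0 < zeta)
  (hHan : forall s : R[i], - zeta < complex.Re s ->
     forall i j, analytic_at (fun z => H z i j) s)
  (hVan : forall s : R[i], - zeta < complex.Re s ->
     forall i, analytic_at (fun z => V z i 0) s)
  (alpha : 'I_N -> R[i] -> R[i])
  (halpha : forall i (s : R[i]), 0 <= complex.Re s -> 0 <= complex.Re (alpha i s))
  (kappa : R) (hkappa : 0 < kappa < 1)
  (hcontr : forall i (s u : R[i]), 0 <= complex.Re s -> 0 <= complex.Re u ->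
     `|alpha i s - alpha i u| <= kappa%:C * `|s - u|)
  (hcomm : forall i j (s : R[i]), 0 <= complex.Re s ->
     alpha i (alpha j s) = alpha j (alpha i s))
  (a : R[i]) (ha : 0 <= complex.Re a) (hfix : forall i, alpha i a = a)
  (hZ : forall s : R[i], 0 <= complex.Re s ->
     jointLST P W Y s
     = H s *m (\sum_i Pmx R i *m jointLST P W Y (alpha i s)) + V s)
  (hEW : ('E_P[W] < +oo)%E)
  (hVa : \forall z \near (a : R[i]^o), forall i,
     analytic_at (fun u => V u i 0) z)
  (hVa0 : V a = 0)
  (hHa : mxnorm1 (H a) * kappa < 1)
  (s : R[i]) (hs : 0 <= complex.Re s) :
  let term := fun i : {ffun 'I_N -> nat} =>
    Fmx alpha H i s *m V (malpha alpha i s) in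
  let ser : nat -> 'cV[R[i]^o]_N :=
    series (fun k => sum_mdeg k term : 'cV[R[i]^o]_N) in
  let tail : nat -> 'cV[R[i]^o]_N := fun n =>
    sum_mdeg n.+1 (fun i => Fmx alpha H i s *m jointLST P W Y a) in
  [/\ cvgn (series (fun k => sum_mdeg k (fun i => mxnorm1 (term i)))),
      cvgn ser,
      cvgn tail &
      jointLST P W Y s = limn ser + limn tail].
Proof.
move=> term ser tail.
have /andP[k0 k1] := hkappa.
have contr k z u : 0 <= complex.Re z -> 0 <= complex.Re u ->
    normc (alpha k z - alpha k u) <= kappa * normc (z - u).
  by move=> z0 u0; have := hcontr k z u z0 u0; rewrite !normcE -rmorphM lecR.
pose al i := malpha alpha i s.
pose D := normc (s - a).
have al_a i : normc (al i - a) <= kappa ^+ mdeg i * D.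
  exact: (malpha_contract halpha hcomm i (ltW k0) contr ha hfix hs).
have D0 : 0 <= D by exact: normc_ge0.
have kn0 e : 0 < e -> forall C, \forall n \near \oo, C * kappa ^+ n < e.
  move=> e0 C; have := @cvg_mulr_expr0 R kappa C.
  rewrite k1 ltW// => /(_ isT)/cvgrPdist_lt/(_ e e0).
  apply: filterS => n; rewrite sub0r normrN; exact: le_lt_trans (ler_norm _).
have aRe : - zeta < complex.Re a.
  by apply: lt_le_trans ha; rewrite oppr_lt0.
(* For large n the points alpha_i(s) with |i| = n enter the disc where f is Lipschitz, and their
   distance to a is at most D kappa^n. *)
have near_a f : analytic_at f a -> exists2 K, 0 <= K &
    \forall n \near \oo, forall i, mdeg i = n ->
      normc (f (al i) - f a) <= K * kappa ^+ n.
  move=> /analytic_at_lipschitz[L [r [L0 r0 hL]]].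
  exists (L * D); first exact: mulr_ge0.
  apply: filterS (kn0 r r0 D) => n Dr i iN.
  have al_i := al_a i; rewrite iN mulrC in al_i.
  apply: le_trans (hL _ (le_lt_trans al_i Dr)) _.
  by rewrite -mulrA ler_wpM2l.
pose m := mxnorm1 (H a).
have m0 : 0 <= m by exact: bigmax_ge_id.
(* The midpoint of m and 1/kappa; the hypothesis m kappa < 1 says that m lies below 1/kappa. *)
have [rho [rho0 mrho q1]] :
    exists rho : R, [/\ 0 < rho, m < rho & rho * kappa < 1].
  have mk : m < kappa^-1 by rewrite -[ltRHS]mul1r ltr_pdivlMr.
  exists ((m + kappa^-1) / 2); split; last by rewrite -ltr_pdivlMr// div1r; lra.
    by rewrite divr_gt0// ltr_wpDl// invr_gt0.
  by lra.
pose q := rho * kappa.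
have q01 : 0 <= q < 1 by rewrite /q mulr_ge0 ?q1 ?ltW.
have q0 : 0 < q by rewrite mulr_gt0.
have N0 : 0 < N%:R :> R by rewrite ltr0n.
(* The slack rho - m is spread over the N rows, so that adding [delta] to every |H(a)_rc| keeps the
   column sums at most rho. *)
pose delta := (rho - m) / N%:R.
have delta0 : 0 < delta by rewrite divr_gt0// subr_gt0.
have [C C0 hC] : exists2 C, 0 <= C & forall n c,
    sum_mdeg n (fun i => colnorm (Fmx alpha H i s) c) <= C * rho ^+ n.
  apply: (@sum_mdeg_Fmx_growth _ _ _ _ _ (fun r c => normc (H a r c) + delta)) => //.
  - by move=> r c; rewrite addr_ge0 ?(ltW delta0)//; exact: normc_ge0.
  - move=> c; rewrite big_split/= sumr_const card_ord -[X in _ + X]mulr_natl.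
    rewrite /delta mulrC divfK ?gt_eqF// -lerBrDr opprB addrC subrK.
    exact: (colnorm_le_mxnorm1 (H a) c).
  - have hrc r c : \forall n \near \oo, forall i, mdeg i = n ->
        normc (H (al i) r c) <= normc (H a r c) + delta.
      have [K K0 hK] := near_a _ (hHan a aRe r c).
      apply: filterS2 hK (kn0 _ delta0 K) => n h1 h2 i iN.
      rewrite -[H (al i) r c](subrK (H a r c)) addrC.
      apply: le_trans (le_normcD _ _) _; rewrite lerD2l.
      by apply: le_trans (h1 i iN) _; exact: ltW.
    have : \forall n \near \oo, forall r c i, mdeg i = n ->
        normc (H (al i) r c) <= normc (H a r c) + delta.
      by apply: filter_forall => r; apply: filter_forall => c; exact: hrc.
    by apply: filterS => n h i iN r c; exact: h.
(* Since V(a) = 0, the Lipschitz bound on V - V(a) is a bound on V itself. *)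
have [L L0 hL] : exists2 L, 0 <= L & \forall n \near \oo, forall i, mdeg i = n ->
    mxnorm1 (V (al i)) <= L * kappa ^+ n.
  have hj j : exists K, 0 <= K /\ \forall n \near \oo, forall i, mdeg i = n ->
      normc (V (al i) j 0) <= K * kappa ^+ n.
    have [K K0 hK] := near_a _ (hVan a aRe j); exists K; split => //.
    apply: filterS hK => n h i iN.
    by have := h i iN; rewrite hVa0 mxE subr0.
  have [K hK] := boolp.choice hj.
  exists (\sum_j K j); first by apply: sumr_ge0 => j _; have [] := hK j.
  have : \forall n \near \oo, forall j i, mdeg i = n ->
      normc (V (al i) j 0) <= K j * kappa ^+ n.
    by apply: filter_forall => j; exact: (hK j).2.
  apply: filterS => n h i iN; rewrite mxnorm1_cV mulr_suml.
  by apply: ler_sum => j _; exact: h.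
have hY1 i : measurable (Y @^-1` [set i]) by exact: hY.
have [M [M0 hM]] := jointLST_lipschitz hW hY1 hEW.
pose Z := jointLST P W Y.
pose B n := sum_mdeg n (fun i => mxnorm1 (term i)).
have B0 n : 0 <= B n.
  by apply: sum_mdeg_ge0 => i; exact: mxnorm1_cV_ge0.
(* The growth rho^n of F and the decay kappa^n of V combine to q^n with q < 1. *)
have [C' C'0 hB] : exists2 C', 0 <= C' & forall n, B n <= C' * q ^+ n.
  apply: (@geometric_bound _ _ _ (N%:R * C * L)) => //.
  apply: filterS hL => n hn.
  apply: le_trans (sum_mdeg_Fmx_le (hC n) hn _) _.
    by rewrite mulr_ge0// exprn_ge0// ltW.
  by rewrite le_eqVlt; apply/orP; left; rewrite exprMn; apply/eqP; ring.
have cvg_abs : cvgn (series B).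
  apply: (@is_cvg_series_geometric_bound _ _ q C') => // n.
  by rewrite B0 hB.
have cvgser : cvgn ser.
  apply: is_cvg_series_mxnorm1; apply: series_le_cvg cvg_abs => // n.
    exact: mxnorm1_cV_ge0.
  exact: mxnorm1_sum_mdeg.
(* The error made in [tail] by replacing Z(alpha_i(s)) with Z(a). *)
pose E n : 'cV[R[i]^o]_N :=
  sum_mdeg n.+1 (fun i => Fmx alpha H i s *m (Z (al i) - Z a)).
have cvgE : E @ \oo --> (0 : 'cV[R[i]^o]_N).
  apply: (@cvg_cV0_mxnorm1 _ _ _ (fun n => (N%:R * C * M * D * q) * q ^+ n)).
    move=> n; apply: le_trans (mxnorm1_sum_mdeg _ _) _.
    apply: (@le_trans _ _ (N%:R * (C * rho ^+ n.+1) * (M * D * kappa ^+ n.+1))).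
      apply: sum_mdeg_Fmx_le => //; last first.
        by rewrite !mulr_ge0// exprn_ge0// ltW.
      move=> i iN; apply: le_trans (hM _ _ _ ha) _.
        exact: malpha_Re.
      by rewrite -mulrA ler_wpM2l// mulrC -iN; exact: al_a.
    by rewrite le_eqVlt; apply/orP; left; rewrite !exprS exprMn /q; apply/eqP; ring.
  exact: cvg_mulr_expr0.
pose Zs : 'cV[R[i]^o]_N := Z s.
(* The equation is iterated n+1 times: [ser n.+1] collects the degrees 0 to n, and the remainder has
   degree n+1 like [tail n]. *)
have tailE n : tail n = Zs - ser n.+1 - E n.
  rewrite /Zs [Z s](iterate_equation halpha hcomm n.+1 hZ hs).
  rewrite /ser /series/= big_mkord [X in X - E n]addrAC subrr add0r.
  apply/eqP; rewrite -subr_eq opprK eq_sym; apply/eqP.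
  rewrite -sum_mdegD; apply: eq_sum_mdeg => i _.
  by rewrite -mulmxDr addrC subrK.
have cvgtail : tail @ \oo --> Zs - limn ser.
  exact: (cvg_remainder_cV cvgser cvgE tailE).
split.
- exact: cvg_abs.
- exact: cvgser.
- exact: cvgP cvgtail.
- by rewrite (lim_cV cvgtail) addrC subrK.
Qed.
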